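(* For all based spaces $K,L$ and every $\Gamma$-space $X$, there is a natural isomorphism of $\Gamma$-spaces $$SP^\infty(K\wedge L,X)=SP^\infty(K,SP^\infty(L,X)).$$
   Context: $\mathcal T$ is the category of based (compactly generated) spaces. $\Gamma$ is the category with objects the based finite sets $\mathbf 0=\emptyset_+$ and $\mathbf n=\{1,\dots,n\}_+$, $n\ge 1$, and all based functions as morphisms. A $\Gamma$-space is a covariant functor $X:\Gamma\to\mathcal T$ with $X(\mathbf 0)=*$; a $\Gamma^{op}$-space is a contravariant functor $Y:\Gamma\to\mathcal T$ with $Y(\mathbf 0)=*$. For a based space $K$, $K^\times$ is the $\Gamma^{op}$-space $K^\times(\mathbf n)=K^n=\mathrm{Map}_{\mathcal T}(\mathbf n,K)$. For a $\Gamma^{op}$-space $Y$ and a $\Gamma$-space $X$, $Y\wedge_\Gamma X$ is the coend: the quotient of $\bigvee_n Y(\mathbf n)\wedge X(\mathbf n)$ by the relation generated by $\alpha^*(y)\wedge x\sim y\wedge\alpha_*(x)$. As a space, $SP^\infty(K,X)=K^\times\wedge_\Gamma X$. It is extended to a functor $SP^\infty:\mathcal T\times\mathcal T^\Gamma\to\mathcal T^\Gamma$ by $SP^\infty(K,X)(\mathbf n)=SP^\infty(K,X_n)$, where $X_n$ is the $\Gamma$-space $X_n(\mathbf m)=X(\mathbf{nm})$, with $\mathbf{nm}$ identified lexicographically with $\mathbf n\wedge\mathbf m$. *)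

(* Defs.v *)
From Stdlib Require Import Relations.
From HB Require Import structures.
From mathcomp Require Import all_boot all_order all_algebra.
From mathcomp Require Import generic_quotient.
From mathcomp Require Import all_classical topology wedge_sigT.

Set Implicit Arguments.
Unset Strict Implicit.
Unset Printing Implicit Defensive.

Local Open Scope classical_set_scope.
Local Open Scope quotient_scope.

(* "Compactly generated" is meant without any separation axiom: the topology
   is the final one for all continuous maps from compact Hausdorff spaces.
   The colimits below (quotients, wedges) are then those of plain spaces. *)
Definition k_open (T : topologicalType) (U : set T) : Prop :=
  forall (C : topologicalType) (f : C -> T),
    compact [set: C] -> hausdorff_space C -> continuous f -> open (f @^-1` U).

HB.mixin Record isCompactlyGenerated T & PointedTopological T := {
  k_open_open : forall U : set T, k_open U -> open U
}.

#[short(type="basedSpaceType")]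
HB.structure Definition BasedSpace :=
  {T of PointedTopological T & isCompactlyGenerated T}.

Lemma open_k_open (T : topologicalType) (U : set T) : open U -> k_open U.
Proof. by move=> oU C f _ _ /continuousP; apply. Qed.

Lemma k_open_preimage (S T : topologicalType) (f : S -> T) (U : set T) :
  continuous f -> k_open U -> k_open (f @^-1` U).
Proof.
move=> cf kU C g cC hC cg; rewrite -comp_preimage; apply: kU => //.
by move=> x; apply: continuous_comp; [exact: cg|exact: cf].
Qed.

(* k-ification: [T] retopologized by its k-open sets. *)
Definition kify (T : ptopologicalType) : Type := T.

Section kify.
Variable T : ptopologicalType.

HB.instance Definition _ := Pointed.copy (kify T) T.

Let kT : @k_open T setT.
Proof. by move=> C f _ _ _; rewrite preimage_setT; exact: openT. Qed.

Let kI (A B : set T) : k_open A -> k_open B -> k_open (A `&` B).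
Proof.
by move=> kA kB C f cC hC cf; rewrite preimage_setI; apply: openI;
  [exact: kA|exact: kB].
Qed.

Let kU (I : Type) (F : I -> set T) :
  (forall i, k_open (F i)) -> k_open (\bigcup_i F i).
Proof.
move=> kF C f cC hC cf; rewrite preimage_bigcup.
by apply: bigcup_open => i _; exact: kF.
Qed.

HB.instance Definition _ :=
  isOpenTopological.Build (kify T) (kT : k_open [set: T]) kI kU.

Lemma kify_openE (U : set (kify T)) : open U = @k_open T U.
Proof. by []. Qed.

Definition from_kify (x : kify T) : T := x.

Lemma from_kify_continuous : continuous from_kify.
Proof. by apply/continuousP => A oA; exact: (open_k_open oA). Qed.

Lemma into_kify (S : topologicalType) (f : S -> kify T) :
  (forall U : set S, k_open U -> open U) ->
  continuous (from_kify \o f) -> continuous f.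
Proof.
move=> kS cf; apply/continuousP => A; rewrite kify_openE => kA.
by apply: kS; exact: (@k_open_preimage S T (from_kify \o f)).
Qed.

Let kify_cg (U : set (kify T)) : k_open U -> open U.
Proof.
move=> kU'; rewrite kify_openE => C f cC hC cf; apply: kU' => //.
apply: (@into_kify C f) => // V kV.
by apply: (kV C id) => // x W.
Qed.

HB.instance Definition _ := isCompactlyGenerated.Build (kify T) kify_cg.

End kify.

Record based_map (A B : basedSpaceType) := BasedMap {
  bm_fun :> A -> B;
  bm_continuous : continuous bm_fun;
  bm_point : bm_fun point = point
}.

Lemma based_idP (A : basedSpaceType) : continuous (@id A).
Proof. by move=> x U. Qed.

Definition based_id (A : basedSpaceType) : based_map A A :=
  BasedMap (@based_idP A) erefl.

Section based_comp.
Variables (A B C : basedSpaceType) (g : based_map B C) (f : based_map A B).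

Lemma based_comp_continuous : continuous (g \o f).
Proof.
by move=> x; apply: continuous_comp; [exact: bm_continuous|exact: bm_continuous].
Qed.

Lemma based_comp_point : (g \o f) point = point.
Proof. by rewrite /= !bm_point. Qed.

Definition based_comp : based_map A C :=
  BasedMap based_comp_continuous based_comp_point.
End based_comp.

HB.instance Definition _ (A B : ptopologicalType) :=
  Pointed.copy (A * B)%type (A * B)%type.

(* The product of compactly generated spaces: k-ified cartesian product. *)
Definition kprod (A B : basedSpaceType) : basedSpaceType := kify (A * B)%type.

Lemma kprod_fst_continuous (A B : basedSpaceType) :
  continuous (fun p : kprod A B => p.1).
Proof.
move=> p.
apply: (@continuous_comp (kprod A B) (A * B)%type A (@from_kify _) fst).
  exact: from_kify_continuous.
exact: cvg_fst.
Qed.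

Lemma kprod_snd_continuous (A B : basedSpaceType) :
  continuous (fun p : kprod A B => p.2).
Proof.
move=> p.
apply: (@continuous_comp (kprod A B) (A * B)%type B (@from_kify _) snd).
  exact: from_kify_continuous.
exact: cvg_snd.
Qed.

Lemma into_kprod (S A B : basedSpaceType) (f : S -> kprod A B) :
  continuous (fun s => (f s).1) -> continuous (fun s => (f s).2) ->
  continuous f.
Proof.
move=> c1 c2; apply: into_kify; first exact: k_open_open.
have -> : @from_kify (A * B)%type \o f = fun s => ((f s).1, (f s).2).
  by apply: funext => s; rewrite -surjective_pairing.
by move=> s; apply: cvg_pair; [exact: c1|exact: c2].
Qed.

Section kprod_map.
Variables (A A' B B' : basedSpaceType).
Variables (f : based_map A A') (g : based_map B B').

Definition kprod_map_fun (p : kprod A B) : kprod A' B' := (f p.1, g p.2).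

Lemma kprod_map_continuous : continuous kprod_map_fun.
Proof.
apply: into_kprod => p.
- apply: (@continuous_comp (kprod A B) A A' (fun p => p.1) f).
    exact: kprod_fst_continuous.
  exact: bm_continuous.
- apply: (@continuous_comp (kprod A B) B B' (fun p => p.2) g).
    exact: kprod_snd_continuous.
  exact: bm_continuous.
Qed.

Lemma kprod_map_point : kprod_map_fun point = point.
Proof. by rewrite /kprod_map_fun !bm_point. Qed.

Definition kprod_map : based_map (kprod A B) (kprod A' B') :=
  BasedMap kprod_map_continuous kprod_map_point.
End kprod_map.

Section gen_equiv.
Variables (T : Type) (R : T -> T -> Prop).

Definition gen_equiv_rel (x y : T) : bool := `[< clos_refl_sym_trans T R x y >].

Lemma gen_equiv_refl : reflexive gen_equiv_rel.
Proof. by move=> x; apply/asboolP; exact: rst_refl. Qed.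

Lemma gen_equiv_sym : symmetric gen_equiv_rel.
Proof.
by move=> x y; apply/idP/idP => /asboolP h; apply/asboolP; exact: rst_sym.
Qed.

Lemma gen_equiv_trans : transitive gen_equiv_rel.
Proof.
move=> y x z /asboolP xy /asboolP yz; apply/asboolP.
exact: rst_trans xy yz.
Qed.

Definition gen_equiv : equiv_rel T :=
  EquivRel gen_equiv_rel gen_equiv_refl gen_equiv_sym gen_equiv_trans.
End gen_equiv.

(* The quotient of a based space by the equivalence relation generated
   by [R]. *)
Definition bquot (T : basedSpaceType) (R : T -> T -> Prop) : Type :=
  {eq_quot gen_equiv R}.

Section bquot.
Variables (T : basedSpaceType) (R : T -> T -> Prop).

HB.instance Definition _ :=
  Topological.copy (bquot R) (quotient_topology {eq_quot gen_equiv R}).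
HB.instance Definition _ := Quotient.on (bquot R).

Definition bquot_pi : T -> bquot R := \pi_(bquot R).

HB.instance Definition _ := isPointed.Build (bquot R) (bquot_pi point).

Lemma bquot_openE (U : set (bquot R)) : open U = open (bquot_pi @^-1` U).
Proof. by []. Qed.

Lemma bquot_pi_continuous : continuous bquot_pi.
Proof. by apply/continuousP => A; rewrite bquot_openE. Qed.

Let bquot_cg (U : set (bquot R)) : k_open U -> open U.
Proof.
move=> kU; rewrite bquot_openE; apply: k_open_open.
exact: k_open_preimage bquot_pi_continuous kU.
Qed.

HB.instance Definition _ := isCompactlyGenerated.Build (bquot R) bquot_cg.

Lemma bquot_piP x y : bquot_pi x = bquot_pi y <-> clos_refl_sym_trans T R x y.
Proof.
by split => [/eqmodP/asboolP|h]; last by apply/eqmodP/asboolP.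
Qed.

Lemma bquot_pi_rel x y : R x y -> bquot_pi x = bquot_pi y.
Proof. by move=> Rxy; apply/bquot_piP; exact: rst_step. Qed.

Lemma bquot_pi_surj (z : bquot R) : exists x, z = bquot_pi x.
Proof. by exists (repr z); rewrite /bquot_pi reprK. Qed.

Section lift.
Variables (Z : basedSpaceType) (f : based_map T Z).
Hypothesis fR : forall x y, R x y -> f x = f y.

Definition bquot_lift_fun (z : bquot R) : Z := f (repr z).

Lemma bquot_lift_funE x : bquot_lift_fun (bquot_pi x) = f x.
Proof.
have fE a b : clos_refl_sym_trans T R a b -> f a = f b.
  by elim=> {a b} [a b /fR//|//|a b _ ->//|a b c _ -> _ ->].
by apply: fE; apply/bquot_piP; rewrite /bquot_pi reprK.
Qed.

Lemma bquot_lift_continuous : continuous bquot_lift_fun.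
Proof.
apply/continuousP => A oA; rewrite bquot_openE.
have -> : bquot_pi @^-1` (bquot_lift_fun @^-1` A) = f @^-1` A.
  by apply/seteqP; split => x /=; rewrite bquot_lift_funE.
by move/continuousP: (@bm_continuous _ _ f); apply.
Qed.

Lemma bquot_lift_point : bquot_lift_fun point = point.
Proof. by rewrite [point]/(bquot_pi point) bquot_lift_funE bm_point. Qed.

Definition bquot_lift : based_map (bquot R) Z :=
  BasedMap bquot_lift_continuous bquot_lift_point.
End lift.

Definition bquot_proj : based_map T (bquot R) :=
  BasedMap bquot_pi_continuous erefl.
End bquot.

Section smash.
Variables A B : basedSpaceType.

Definition on_axes (p : kprod A B) : Prop := p.1 = point \/ p.2 = point.

Definition smash : basedSpaceType :=
  bquot (fun p q : kprod A B => on_axes p /\ on_axes q).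

Definition smash_pair (a : A) (b : B) : smash := bquot_pi _ ((a, b) : kprod A B).

Lemma smash_surj (z : smash) : exists a b, z = smash_pair a b.
Proof. by have [[a b] ->] := bquot_pi_surj z; exists a, b. Qed.

End smash.

Section smash_map.
Variables (A A' B B' : basedSpaceType).
Variables (f : based_map A A') (g : based_map B B').

Let smash_map_rel (p q : kprod A B) : on_axes p /\ on_axes q ->
  based_comp (bquot_proj _) (kprod_map f g) p =
  based_comp (bquot_proj _) (kprod_map f g) q :> smash A' B'.
Proof.
move=> [hp hq]; apply: bquot_pi_rel.
by split; [case: hp|case: hq] => h; [left|right|left|right];
  rewrite /= h bm_point.
Qed.

Definition smash_map : based_map (smash A B) (smash A' B') :=
  bquot_lift smash_map_rel.

Lemma smash_mapE a b :
  smash_map (smash_pair a b) = smash_pair (f a) (g b).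
Proof. exact: (bquot_lift_funE smash_map_rel). Qed.

End smash_map.

Definition bwedge (F : nat -> basedSpaceType) : Type :=
  pwedge (fun n => F n : ptopologicalType).

Section bwedge.
Variable F : nat -> basedSpaceType.

HB.instance Definition _ := PointedTopological.copy (bwedge F)
  (pwedge (fun n => F n : ptopologicalType)).

Definition bwedge_in n : F n -> bwedge F :=
  @wedge_lift _ (fun n => F n : topologicalType) (fun n => point) n.

Lemma bwedge_in_continuous n : continuous (@bwedge_in n).
Proof. exact: wedge_lift_continuous. Qed.

Let bwedge_cg (U : set (bwedge F)) : k_open U -> open U.
Proof.
move=> kU; apply/wedge_openP => n; apply: k_open_open.
exact: k_open_preimage (@bwedge_in_continuous n) kU.
Qed.

HB.instance Definition _ := isCompactlyGenerated.Build (bwedge F) bwedge_cg.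

Lemma bwedge_in_point n : bwedge_in (point : F n) = point.
Proof.
exact: (@wedge_liftE _ (fun n => F n : topologicalType) (fun n => point)
  (@point nat) point n point).
Qed.

Lemma bwedge_surj (z : bwedge F) : exists n x, z = @bwedge_in n x.
Proof.
have : [set: wedge (fun n => point : F n)] z by [].
by rewrite -wedgeTE => -[n _ [x _ <-]]; exists n, x.
Qed.

Section lift.
Variables (Z : basedSpaceType) (f : forall n, based_map (F n) Z).

Definition bwedge_lift_fun (z : bwedge F) : Z :=
  @wedge_fun _ (fun n => F n : topologicalType) (fun n => point) Z
    (fun n => f n) z.

Lemma bwedge_lift_funE n (x : F n) : bwedge_lift_fun (bwedge_in x) = f n x.
Proof.
by apply: (@wedge_lift_funE _ (fun n => F n : topologicalType)) => i j;
  rewrite !bm_point.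
Qed.

Lemma bwedge_lift_continuous : continuous bwedge_lift_fun.
Proof.
apply: wedge_fun_continuous => [n|i j]; first exact: bm_continuous.
by rewrite !bm_point.
Qed.

Lemma bwedge_lift_point : bwedge_lift_fun point = point.
Proof. by rewrite -(bwedge_in_point 0) bwedge_lift_funE bm_point. Qed.

Definition bwedge_lift : based_map (bwedge F) Z :=
  BasedMap bwedge_lift_continuous bwedge_lift_point.
End lift.

Definition bwedge_incl n : based_map (F n) (bwedge F) :=
  BasedMap (@bwedge_in_continuous n) (bwedge_in_point n).
End bwedge.

(* The object {1, ..., n}_+ is [option 'I_n], with base point [None]. *)
Record gamma_hom (m n : nat) := GammaHom {
  gh_fun :> option 'I_m -> option 'I_n;
  gh_point : gh_fun None = None
}.

Lemma gamma_hom_eq m n (f g : gamma_hom m n) : f =1 g -> f = g.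
Proof.
case: f g => [f f0] [g g0] /= /funext fg; subst g.
by rewrite (Prop_irrelevance f0 g0).
Qed.

Definition gamma_id n : gamma_hom n n := @GammaHom n n id erefl.

Lemma gamma_comp_point m n p (g : gamma_hom n p) (f : gamma_hom m n) :
  (g \o f) None = None.
Proof. by rewrite /= !gh_point. Qed.

Definition gamma_comp m n p (g : gamma_hom n p) (f : gamma_hom m n) :
  gamma_hom m p := GammaHom (gamma_comp_point g f).

Lemma lex_subproof n m (i : 'I_n) (j : 'I_m) : i * m + j < n * m.
Proof.
have h : i * m + m <= n * m by rewrite -mulSnr leq_mul2r ltn_ord orbT.
by apply: leq_trans h; rewrite ltn_add2l.
Qed.

Definition lex n m (i : 'I_n) (j : 'I_m) : 'I_(n * m) :=
  Ordinal (lex_subproof i j).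

Lemma unlex1_subproof n m (k : 'I_(n * m)) : k %/ m < n.
Proof.
have m0 : 0 < m by case: m k => [[k]|//]; rewrite muln0.
by rewrite ltn_divLR.
Qed.

Lemma unlex2_subproof n m (k : 'I_(n * m)) : k %% m < m.
Proof.
have m0 : 0 < m by case: m k => [[k]|//]; rewrite muln0.
by rewrite ltn_mod.
Qed.

Definition unlex n m (k : 'I_(n * m)) : 'I_n * 'I_m :=
  (Ordinal (unlex1_subproof k), Ordinal (unlex2_subproof k)).

Lemma lexK n m (i : 'I_n) (j : 'I_m) : unlex (lex i j) = (i, j).
Proof.
have m0 : 0 < m by case: j => j; case: m.
congr pair; apply: val_inj => /=.
  by rewrite divnMDl // divn_small // addn0.
by rewrite modnMDl modn_small.
Qed.

Lemma unlexK n m (k : 'I_(n * m)) : lex (unlex k).1 (unlex k).2 = k.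
Proof. by apply: val_inj; rewrite /= -divn_eq. Qed.

(* The smash product of based functions, the smash product of {1, ..., n}_+
   and {1, ..., m}_+ being identified with {1, ..., n * m}_+ . *)
Definition gamma_smash_fun n n' m m' (a : gamma_hom n n') (b : gamma_hom m m')
    (k : option 'I_(n * m)) : option 'I_(n' * m') :=
  if k is Some k then
    match a (Some (unlex k).1), b (Some (unlex k).2) with
    | Some i, Some j => Some (lex i j)
    | _, _ => None
    end
  else None.

Definition gamma_smash n n' m m' (a : gamma_hom n n') (b : gamma_hom m m') :
    gamma_hom (n * m) (n' * m') :=
  @GammaHom (n * m) (n' * m') (gamma_smash_fun a b) erefl.

Lemma gamma_smash_id n m : gamma_smash (gamma_id n) (gamma_id m) = gamma_id _.
Proof. by apply: gamma_hom_eq => -[k|] //=; rewrite unlexK. Qed.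

Lemma gamma_smash_comp n n' n'' m m' m''
    (a' : gamma_hom n' n'') (a : gamma_hom n n')
    (b' : gamma_hom m' m'') (b : gamma_hom m m') :
  gamma_smash (gamma_comp a' a) (gamma_comp b' b) =
  gamma_comp (gamma_smash a' b') (gamma_smash a b).
Proof.
apply: gamma_hom_eq => -[k|] //.
rewrite [LHS]/= [RHS]/= /gamma_smash_fun.
move: (unlex k) => [i j] /=.
case: (a _) => [i'|] /=; last by rewrite gh_point.
case: (b _) => [j'|] /=; last by rewrite gh_point; case: (a' _).
by have := lexK i' j'; rewrite /unlex => -[-> ->].
Qed.

Record GammaSpace := {
  gs_obj :> nat -> basedSpaceType;
  gs_map : forall m n, gamma_hom m n -> based_map (gs_obj m) (gs_obj n);
  gs_map_id : forall n x, gs_map (gamma_id n) x = x;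
  gs_map_comp : forall m n p (g : gamma_hom n p) (f : gamma_hom m n) x,
    gs_map (gamma_comp g f) x = gs_map g (gs_map f x);
  gs_zero : forall x : gs_obj 0, x = point
}.

Record gamma_nat (X Y : GammaSpace) := GammaNat {
  gn_fun :> forall n, based_map (X n) (Y n);
  gn_natural : forall m n (f : gamma_hom m n) x,
    gn_fun n (gs_map X f x) = gs_map Y f (gn_fun m x)
}.

Definition gamma_nat_id (X : GammaSpace) : gamma_nat X X :=
  @GammaNat X X (fun n => based_id (X n)) (fun _ _ _ _ => erefl).

Lemma gamma_nat_comp_natural (X Y Z : GammaSpace) (g : gamma_nat Y Z)
    (f : gamma_nat X Y) m n (a : gamma_hom m n) x :
  based_comp (g n) (f n) (gs_map X a x) =
  gs_map Z a (based_comp (g m) (f m) x).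
Proof. by rewrite /= !gn_natural. Qed.

Definition gamma_nat_comp (X Y Z : GammaSpace) (g : gamma_nat Y Z)
    (f : gamma_nat X Y) : gamma_nat X Z :=
  GammaNat (gamma_nat_comp_natural g f).

Definition gamma_is_iso (X Y : GammaSpace) (f : gamma_nat X Y) : Prop :=
  exists g : gamma_nat Y X,
    forall n, cancel (f n) (g n) /\ cancel (g n) (f n).

Record GammaOpSpace := {
  gos_obj :> nat -> basedSpaceType;
  gos_map : forall m n, gamma_hom m n -> based_map (gos_obj n) (gos_obj m);
  gos_map_id : forall n y, gos_map (gamma_id n) y = y;
  gos_map_comp : forall m n p (g : gamma_hom n p) (f : gamma_hom m n) y,
    gos_map (gamma_comp g f) y = gos_map f (gos_map g y);
  gos_zero : forall y : gos_obj 0, y = point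
}.

Record gammaop_nat (X Y : GammaOpSpace) := GammaOpNat {
  gon_fun :> forall n, based_map (X n) (Y n);
  gon_natural : forall m n (f : gamma_hom m n) y,
    gon_fun m (gos_map X f y) = gos_map Y f (gon_fun n y)
}.

HB.instance Definition _ (I : Type) (T : I -> ptopologicalType) :=
  isPointed.Build (prod_topology T) (fun=> point).

(* [K^n], as the based maps from {1, ..., n}_+ to [K]. *)
Definition kpow (K : basedSpaceType) (n : nat) : basedSpaceType :=
  kify {ptws 'I_n -> K}.

(* The extension of [y] to a based function on {1, ..., n}_+ . *)
Definition kpow_ext (K : basedSpaceType) n (y : kpow K n) (i : option 'I_n) : K :=
  if i is Some i then y i else point.

Lemma ptws_continuous (S : topologicalType) (K : basedSpaceType) n
    (f : S -> {ptws 'I_n -> K}) :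
  (forall i, continuous (fun s => f s i)) -> continuous f.
Proof.
move=> cf s; apply/cvg_sup => i.
apply: (@continuous_comp_initial _ _ _ (fun g : 'I_n -> K => g i) f).
exact: cf.
Qed.

Lemma into_kpow (S K : basedSpaceType) n (f : S -> kpow K n) :
  (forall i, continuous (fun s => f s i)) -> continuous f.
Proof.
move=> cf; apply: into_kify; first exact: k_open_open.
exact: ptws_continuous.
Qed.

Lemma kpow_proj_continuous (K : basedSpaceType) n (i : 'I_n) :
  continuous (fun y : kpow K n => y i).
Proof.
move=> y.
apply: (@continuous_comp (kpow K n) {ptws 'I_n -> K} K
  (@from_kify _) (fun z => z i)).
  exact: from_kify_continuous.
exact: (@proj_continuous _ (fun=> K)).
Qed.

Lemma kpow_ext_continuous (K : basedSpaceType) n (i : option 'I_n) :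
  continuous (fun y : kpow K n => kpow_ext y i).
Proof.
by case: i => [i|]; [exact: kpow_proj_continuous|exact: cst_continuous].
Qed.

Section kpow_map.
Variables (K : basedSpaceType) (m n : nat) (f : gamma_hom m n).

Definition kpow_map_fun (y : kpow K n) : kpow K m :=
  fun i => kpow_ext y (f (Some i)).

Lemma kpow_map_continuous : continuous kpow_map_fun.
Proof. by apply: into_kpow => i; exact: kpow_ext_continuous. Qed.

Lemma kpow_map_point : kpow_map_fun point = point.
Proof.
by apply: funext => i; rewrite /kpow_map_fun; case: (f _).
Qed.

Definition kpow_map : based_map (kpow K n) (kpow K m) :=
  BasedMap kpow_map_continuous kpow_map_point.

Lemma kpow_map_ext (y : kpow K n) i :
  kpow_ext (kpow_map y) i = kpow_ext y (f i).
Proof. by case: i => [i|] //=; rewrite gh_point. Qed.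
End kpow_map.

Lemma kpow_map_id (K : basedSpaceType) n (y : kpow K n) :
  kpow_map K (gamma_id n) y = y.
Proof. exact: funext. Qed.

Lemma kpow_map_comp (K : basedSpaceType) m n p
    (g : gamma_hom n p) (f : gamma_hom m n) (y : kpow K p) :
  kpow_map K (gamma_comp g f) y = kpow_map K f (kpow_map K g y).
Proof. by apply: funext => i; rewrite [RHS]kpow_map_ext. Qed.

Lemma kpow_zero (K : basedSpaceType) (y : kpow K 0) : y = point.
Proof. by apply: funext => -[]. Qed.

Definition power (K : basedSpaceType) : GammaOpSpace :=
  Build_GammaOpSpace (@kpow_map_id K) (@kpow_map_comp K) (@kpow_zero K).

Section power_nat.
Variables (K K' : basedSpaceType) (k : based_map K K').

Definition power_nat_fun n (y : kpow K n) : kpow K' n := fun i => k (y i).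

Lemma power_nat_continuous n : continuous (@power_nat_fun n).
Proof.
apply: into_kpow => i y.
apply: (@continuous_comp (kpow K n) K K' (fun y => y i) k).
  exact: kpow_proj_continuous.
exact: bm_continuous.
Qed.

Lemma power_nat_point n : @power_nat_fun n point = point.
Proof. by apply: funext => i; exact: bm_point. Qed.

Lemma power_nat_natural m n (f : gamma_hom m n) (y : kpow K n) :
  power_nat_fun (kpow_map K f y) = kpow_map K' f (power_nat_fun y).
Proof.
apply: funext => i; rewrite /power_nat_fun /= /kpow_map_fun.
by case: (f _) => //=; rewrite bm_point.
Qed.

Definition power_nat : gammaop_nat (power K) (power K') :=
  @GammaOpNat (power K) (power K')
    (fun n => BasedMap (@power_nat_continuous n) (power_nat_point n))
    power_nat_natural.
End power_nat.

Lemma power_nat_id (K : basedSpaceType) n (y : power K n) :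
  power_nat (based_id K) n y = y.
Proof. exact: funext. Qed.

Lemma power_nat_comp (K K' K'' : basedSpaceType) (k' : based_map K' K'')
    (k : based_map K K') n (y : power K n) :
  power_nat (based_comp k' k) n y = power_nat k' n (power_nat k n y).
Proof. exact: funext. Qed.

Section coend.
Variables (Y : GammaOpSpace) (X : GammaSpace).

Definition coend_sum : basedSpaceType := bwedge (fun n => smash (Y n) (X n)).

Definition coend_gen n (y : Y n) (x : X n) : coend_sum :=
  @bwedge_in (fun n => smash (Y n) (X n)) n (smash_pair y x).

Definition coend_rel (u v : coend_sum) : Prop :=
  exists m n (a : gamma_hom m n) (y : Y n) (x : X m),
    u = coend_gen (gos_map Y a y) x /\ v = coend_gen y (gs_map X a x).

Definition coend : basedSpaceType := bquot coend_rel.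

Definition coend_class n (y : Y n) (x : X n) : coend :=
  bquot_pi _ (coend_gen y x).

Lemma coend_surj (z : coend) : exists n y x, z = @coend_class n y x.
Proof.
have [w ->] := bquot_pi_surj z.
have [n [s ->]] := bwedge_surj w.
by have [y [x ->]] := smash_surj s; exists n, y, x.
Qed.

Lemma coend_class_point n (y : Y n) : coend_class y (point : X n) = point.
Proof.
have E : coend_gen y (point : X n) = point :> coend_sum.
  rewrite -(bwedge_in_point (fun n => smash (Y n) (X n)) n) /coend_gen.
  by congr (@bwedge_in _ n _); apply: bquot_pi_rel; split; right.
by rewrite /coend_class E.
Qed.

Lemma coend_classE m n (a : gamma_hom m n) (y : Y n) (x : X m) :
  coend_class (gos_map Y a y) x = coend_class y (gs_map X a x).
Proof. by apply: bquot_pi_rel; exists m, n, a, y, x. Qed.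

End coend.

Section coend_map.
Variables (Y Y' : GammaOpSpace) (X X' : GammaSpace).
Variables (u : gammaop_nat Y Y') (v : gamma_nat X X').

Definition coend_sum_map : based_map (coend_sum Y X) (coend_sum Y' X') :=
  bwedge_lift (fun n =>
    based_comp (bwedge_incl (fun n => smash (Y' n) (X' n)) n)
      (smash_map (u n) (v n))).

Lemma coend_sum_mapE n (y : Y n) (x : X n) :
  coend_sum_map (coend_gen y x) = coend_gen (u n y) (v n x).
Proof.
rewrite /coend_sum_map /coend_gen /= bwedge_lift_funE /=.
by congr bwedge_in; exact: smash_mapE.
Qed.

Let coend_map_rel p q : coend_rel p q ->
  based_comp (bquot_proj (@coend_rel Y' X')) coend_sum_map p =
  based_comp (bquot_proj (@coend_rel Y' X')) coend_sum_map q.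
Proof.
move=> [m [n [a [y [x [-> ->]]]]]]; apply: bquot_pi_rel.
rewrite !coend_sum_mapE gon_natural gn_natural.
by exists m, n, a, (u n y), (v m x).
Qed.

Definition coend_map : based_map (coend Y X) (coend Y' X') :=
  bquot_lift coend_map_rel.

Lemma coend_mapE n (y : Y n) (x : X n) :
  coend_map (coend_class y x) = coend_class (u n y) (v n x).
Proof.
rewrite /coend_class -coend_sum_mapE.
exact: (bquot_lift_funE coend_map_rel).
Qed.
End coend_map.

Section shift.
Variables (X : GammaSpace) (n : nat).

Definition shift_map m p (b : gamma_hom m p) :
    based_map (X (n * m)) (X (n * p)) := gs_map X (gamma_smash (gamma_id n) b).

Lemma shift_map_id m (x : X (n * m)) : shift_map (gamma_id m) x = x.
Proof. by rewrite /shift_map gamma_smash_id gs_map_id. Qed.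

Lemma shift_map_comp m p q (g : gamma_hom p q) (f : gamma_hom m p)
    (x : X (n * m)) :
  shift_map (gamma_comp g f) x = shift_map g (shift_map f x).
Proof.
rewrite /shift_map -gs_map_comp -gamma_smash_comp.
by congr (gs_map X (gamma_smash _ _) _); exact: gamma_hom_eq.
Qed.

Lemma shift_zero (x : X (n * 0)) : x = point.
Proof. by move: x; rewrite muln0; exact: gs_zero. Qed.

Definition shift : GammaSpace :=
  @Build_GammaSpace (fun m => X (n * m)) shift_map
    shift_map_id shift_map_comp shift_zero.
End shift.

Section shift_nat.
Variables (X : GammaSpace) (n n' : nat) (a : gamma_hom n n').

Definition shift_hom_fun m : based_map (shift X n m) (shift X n' m) :=
  gs_map X (gamma_smash a (gamma_id m)).

Lemma shift_hom_natural m p (b : gamma_hom m p) (x : shift X n m) :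
  shift_hom_fun p (gs_map (shift X n) b x) =
  gs_map (shift X n') b (shift_hom_fun m x).
Proof.
rewrite /shift_hom_fun /= /shift_map -!gs_map_comp -!gamma_smash_comp.
by congr (gs_map X (gamma_smash _ _) _); exact: gamma_hom_eq.
Qed.

Definition shift_hom : gamma_nat (shift X n) (shift X n') :=
  GammaNat shift_hom_natural.
End shift_nat.

Lemma shift_hom_id (X : GammaSpace) n m (x : shift X n m) :
  shift_hom X (gamma_id n) m x = x.
Proof. by rewrite /= /shift_hom_fun gamma_smash_id gs_map_id. Qed.

Lemma shift_hom_comp (X : GammaSpace) m n p
    (g : gamma_hom n p) (f : gamma_hom m n) q (x : shift X m q) :
  shift_hom X (gamma_comp g f) q x = shift_hom X g q (shift_hom X f q x).
Proof.
rewrite /= /shift_hom_fun -gs_map_comp -gamma_smash_comp.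
by congr (gs_map X (gamma_smash _ _) _); exact: gamma_hom_eq.
Qed.

Section shift_fun.
Variables (X X' : GammaSpace) (f : gamma_nat X X') (n : nat).

Lemma shift_fun_natural m p (b : gamma_hom m p) (x : shift X n m) :
  f (n * p) (gs_map (shift X n) b x) = gs_map (shift X' n) b (f (n * m) x).
Proof. exact: gn_natural. Qed.

Definition shift_fun : gamma_nat (shift X n) (shift X' n) :=
  @GammaNat (shift X n) (shift X' n) (fun m => f (n * m)) shift_fun_natural.
End shift_fun.

Section SPinf.
Variables (K : basedSpaceType) (X : GammaSpace).

Definition SPspace (Z : GammaSpace) : basedSpaceType := coend (power K) Z.

Definition SPinf_hom m n (a : gamma_hom m n) :
    based_map (SPspace (shift X m)) (SPspace (shift X n)) :=
  coend_map (power_nat (based_id K)) (shift_hom X a).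

Lemma SPinf_hom_id n (z : SPspace (shift X n)) :
  SPinf_hom (gamma_id n) z = z.
Proof.
have [m [y [x ->]]] := coend_surj z.
by rewrite /SPinf_hom coend_mapE power_nat_id shift_hom_id.
Qed.

Lemma SPinf_hom_comp m n p (g : gamma_hom n p) (f : gamma_hom m n)
    (z : SPspace (shift X m)) :
  SPinf_hom (gamma_comp g f) z = SPinf_hom g (SPinf_hom f z).
Proof.
have [q [y [x ->]]] := coend_surj z.
rewrite /SPinf_hom [LHS]coend_mapE [X in _ = bm_fun _ X]coend_mapE.
by rewrite [RHS]coend_mapE !power_nat_id shift_hom_comp.
Qed.

Lemma SPinf_zero (z : SPspace (shift X 0)) : z = point.
Proof.
have [m [y [x ->]]] := coend_surj z.
have -> : x = point by exact: (gs_zero (x : X 0)).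
exact: coend_class_point.
Qed.

Definition SPinf : GammaSpace :=
  @Build_GammaSpace (fun n => SPspace (shift X n)) SPinf_hom
    SPinf_hom_id SPinf_hom_comp SPinf_zero.
End SPinf.

Section SPinf_map.
Variables (K K' : basedSpaceType) (X X' : GammaSpace).
Variables (k : based_map K K') (f : gamma_nat X X').

Definition SPinf_map_fun n : based_map (SPinf K X n) (SPinf K' X' n) :=
  coend_map (power_nat k) (shift_fun f n).

Lemma SPinf_map_natural m n (a : gamma_hom m n) (z : SPinf K X m) :
  SPinf_map_fun n (gs_map (SPinf K X) a z) =
  gs_map (SPinf K' X') a (SPinf_map_fun m z).
Proof.
have [q [y [x ->]]] := coend_surj z.
rewrite [X in SPinf_map_fun n X]coend_mapE [LHS]coend_mapE.
rewrite [X in _ = bm_fun _ X]coend_mapE [RHS]coend_mapE !power_nat_id.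
by congr (@coend_class (power K') (shift X' n) q _ _); exact: (gn_natural f).
Qed.

Definition SPinf_map : gamma_nat (SPinf K X) (SPinf K' X') :=
  GammaNat SPinf_map_natural.
End SPinf_map.

Lemma SPinf_map_id (K : basedSpaceType) (X : GammaSpace) n (z : SPinf K X n) :
  SPinf_map (based_id K) (gamma_nat_id X) n z = z.
Proof.
have [q [y [x ->]]] := coend_surj z.
by rewrite [LHS]coend_mapE power_nat_id.
Qed.

Lemma SPinf_map_comp (K K' K'' : basedSpaceType) (X X' X'' : GammaSpace)
    (k' : based_map K' K'') (k : based_map K K')
    (f' : gamma_nat X' X'') (f : gamma_nat X X') n (z : SPinf K X n) :
  SPinf_map (based_comp k' k) (gamma_nat_comp f' f) n z =
  SPinf_map k' f' n (SPinf_map k f n z).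
Proof.
have [q [y [x ->]]] := coend_surj z.
rewrite [LHS]coend_mapE [X in _ = bm_fun _ X]coend_mapE [RHS]coend_mapE.
by rewrite power_nat_comp.
Qed.

(* Main.v *)
(* A class of SP(K ^ L, X)(q) is given by k_i ^ l_i, for i <= n, and a point x
   of X(qn). It is sent to [k; [l; d x]], where d is induced by the diagonal of
   {1, ..., n}_+ ; the inverse sends [k; [l; x]] to the class of the exterior
   family (k_a ^ l_b) and x. The coend relations give
   [e^* k; [l; d x]] = [k; [e^* l; d x]] for the maps e sending some indices to
   the base point, so that [k; [l; d x]] depends on the k_i ^ l_i only. Both
   maps are defined on quotients of products; they are continuous because, for
   compactly generated spaces, the product with a fixed space, and hence a
   finite power, preserves quotient maps. *)
Require Import Defs.
From mathcomp Require Import all_boot all_order all_classical topology.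
From mathcomp Require Import wedge_sigT.

Set Implicit Arguments.
Unset Strict Implicit.
Unset Printing Implicit Defensive.

Local Open Scope classical_set_scope.

(** * Products of quotient maps between compactly generated spaces *)

Lemma hausdorff_prod (S T : topologicalType) :
  hausdorff_space S -> hausdorff_space T -> hausdorff_space (S * T)%type.
Proof.
move=> hS hT [a b] [c d] cl.
have cvg_fst' (p : S * T) U : nbhs p.1 U -> nbhs p (fst @^-1` U).
  exact: cvg_fst.
have cvg_snd' (p : S * T) U : nbhs p.2 U -> nbhs p (snd @^-1` U).
  exact: cvg_snd.
congr pair; [apply: hS|apply: hT] => U V nU nV.
- by have [[x y] [? ?]] := cl _ _ (cvg_fst' (a, b) U nU) (cvg_fst' (c, d) V nV);
    exists x.
- by have [[x y] [? ?]] := cl _ _ (cvg_snd' (a, b) U nU) (cvg_snd' (c, d) V nV);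
    exists y.
Qed.

(** Each (s, t) with t in [N] has a box inside [W]; the near-covering form of compactness of [N]
    yields one neighbourhood of s that serves all t. *)
Lemma tube_open (S T : topologicalType) (W : set (S * T)) (N : set T) :
  compact N -> open W -> open [set s | forall t, N t -> W (s, t)].
Proof.
move=> /compact_near_coveringP cN oW; rewrite openE => s sW /=.
apply: (cN S (nbhs s) (fun s t => W (s, t))) => t Nt.
have : nbhs (s, t) W by apply: open_nbhs_nbhs; split => //; exact: sW.
move=> [[P Q] /= [nP nQ] PQ]; exists (Q, P) => //= -[t' s'] [/= Qt Ps].
exact: (PQ (s', t')).
Qed.

(* The maps [q i] exhibit [B] as a quotient of the disjoint union of the
   [A i]. *)
Definition jointly_quotient (I : Type) (A : I -> basedSpaceType)
    (B : basedSpaceType) (q : forall i, A i -> B) : Prop :=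
  [/\ forall b, exists i a, q i a = b,
      forall i, continuous (q i) &
      forall U : set B, (forall i, open (q i @^-1` U)) -> open U].

Lemma jointly_quotient_continuous (I : Type) (A : I -> basedSpaceType)
    (B Z : basedSpaceType) (q : forall i, A i -> B) (f : B -> Z) :
  jointly_quotient q -> (forall i, continuous (f \o q i)) -> continuous f.
Proof.
move=> [_ _ qop] cf; apply/continuousP => U oU; apply: qop => i.
by rewrite comp_preimage; move/continuousP: (cf i); apply.
Qed.

(* Openness is tested along maps [(f1, f2)] from a compact Hausdorff space.
   Near [h0] the test reduces to the set [V] of the points [b] such that
   [(b, f2 h)] is in [U] for all [h] in a compact neighbourhood of [h0]; by the
   tube lemma its preimages under the [q i] are open, hence so is [V]. *)
Lemma jointly_quotient_prodl (I : Type) (A : I -> basedSpaceType)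
    (B C : basedSpaceType) (q : forall i, A i -> B) :
  jointly_quotient q ->
  jointly_quotient (A := fun i => kprod (A i) C) (B := kprod B C)
    (fun i p => (q i p.1, p.2)).
Proof.
move=> [qs qc qo]; split.
- by move=> [b c]; have [i [a <-]] := qs b; exists i, (a, c).
- move=> i; apply: into_kprod => p /=.
    apply: (@continuous_comp (kprod (A i) C) (A i) B (fun p => p.1)).
      exact: kprod_fst_continuous.
    exact: qc.
  exact: kprod_snd_continuous.
move=> U oU; rewrite kify_openE => H f cH hH cf.
pose f1 : H -> B := fst \o f; pose f2 : H -> C := snd \o f.
have cf1 : continuous f1.
  by move=> h; apply: continuous_comp; [exact: cf|exact: cvg_fst].
have cf2 : continuous f2.
  by move=> h; apply: continuous_comp; [exact: cf|exact: cvg_snd].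
rewrite openE => h0 /= Uh0.
have fE h : f h = (f1 h, f2 h) by rewrite /f1 /f2 /= -surjective_pairing.
have [i0 [a0 a0E]] := qs (f1 h0).
(* Lifting [f1 h0] to [a0] turns the slice into a test of the open set [q i0 x id] pulls back from
   [U], along h |-> (a0, f2 h). *)
have slice : nbhs h0 [set h | U (f1 h0, f2 h)].
  apply: open_nbhs_nbhs; split; last by rewrite /= -fE.
  rewrite -a0E; apply: (oU i0 H (fun h => (a0, f2 h))) => // h.
  by apply: cvg_pair => /=; [exact: cvg_cst|exact: cf2].
have [N nN NU] := compact_regular hH cH filterT slice.
pose V := [set b | forall h, closure N h -> U (b, f2 h)].
have cN : compact (closure N).
  by apply: (subclosed_compact _ cH) => //; exact: closed_closure.
have oV : open V.
  apply: qo => i; apply: k_open_open => D g cD hD cg.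
  apply: (@tube_open D H [set dh | U (q i (g dh.1), f2 dh.2)]) => //.
  (* Openness in [kprod (A i) C] is k-openness, and [D * H], again compact Hausdorff, is an
     admissible test space. *)
  apply: (oU i (D * H)%type (fun dh => (g dh.1, f2 dh.2))).
  - by rewrite -setXTT; exact: compact_setX.
  - exact: hausdorff_prod.
  - have c1 : continuous (g \o (@fst D H)).
      by move=> dh; apply: continuous_comp; [exact: cvg_fst|exact: cg].
    have c2 : continuous (f2 \o (@snd D H)).
      by move=> dh; apply: continuous_comp; [exact: cvg_snd|exact: cf2].
    by move=> dh; apply: cvg_pair; [exact: c1|exact: c2].
have nV : nbhs h0 (f1 @^-1` V).
  by apply: cf1; apply: open_nbhs_nbhs; split.
apply: filterS (filterI nV nN) => h [/= Vh Nh].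
by rewrite fE; apply: Vh; exact: subset_closure.
Qed.

Lemma jointly_quotient_prodr (I : Type) (A : I -> basedSpaceType)
    (B C : basedSpaceType) (q : forall i, A i -> B) :
  jointly_quotient q ->
  jointly_quotient (A := fun i => kprod C (A i)) (B := kprod C B)
    (fun i p => (p.1, q i p.2)).
Proof.
move=> qq; have [qs qc _] := qq; split.
- by move=> [c b]; have [i [a <-]] := qs b; exists i, (c, a).
- move=> i; apply: into_kprod => p /=; first exact: kprod_fst_continuous.
  apply: (@continuous_comp (kprod C (A i)) (A i) B (fun p => p.2)).
    exact: kprod_snd_continuous.
  exact: qc.
move=> U oU; have [_ _ qo] := jointly_quotient_prodl C qq.
(* Conjugation by the exchange of factors reduces this to [jointly_quotient_prodl]. *)
pose swap (D E : basedSpaceType) (p : kprod D E) : kprod E D := (p.2, p.1).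
have cswap D E : continuous (@swap D E).
  apply: into_kprod; first exact: kprod_snd_continuous.
  exact: kprod_fst_continuous.
have -> : U = @swap C B @^-1` (@swap B C @^-1` U).
  by apply/seteqP; split=> -[].
move/continuousP: (cswap C B); apply; apply: qo => i.
have /continuousP /(_ _ (oU i)) := cswap (A i) C.
by congr open.
Qed.

(** * Topology and universal property of the coend *)

(** The class map is the projection to the smash product, then the inclusion in the wedge, then the
    coend quotient; each stage carries the final topology. *)
Lemma coend_class_jointly_quotient (Y : GammaOpSpace) (X : GammaSpace) :
  jointly_quotient (fun n (p : kprod (Y n) (X n)) => coend_class p.1 p.2).
Proof.
have classE n : (fun p : kprod (Y n) (X n) => coend_class p.1 p.2) =
    bquot_pi (@coend_rel Y X) \o @bwedge_in (fun n => smash (Y n) (X n)) n \o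
    bquot_pi (fun p q : kprod (Y n) (X n) => on_axes p /\ on_axes q).
  by apply: funext => -[y x].
split.
- by move=> z; have [n [y [x ->]]] := coend_surj z; exists n, (y, x).
- move=> n; rewrite classE => p.
  apply: continuous_comp; first exact: bquot_pi_continuous.
  apply: continuous_comp; first exact: bwedge_in_continuous.
  exact: bquot_pi_continuous.
move=> U oU; rewrite bquot_openE; apply/wedge_openP => n.
by rewrite bquot_openE; move: (oU n); rewrite classE.
Qed.

Lemma coend_class_continuous (Y : GammaOpSpace) (X : GammaSpace)
    (S : basedSpaceType) n (y : S -> Y n) (x : S -> X n) :
  continuous y -> continuous x ->
  continuous (fun s => coend_class (y s) (x s)).
Proof.
move=> cy cx; have [_ cc _] := coend_class_jointly_quotient Y X.
have cyx : continuous (fun s => (y s, x s) : kprod (Y n) (X n)).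
  exact: into_kprod.
move=> s; apply: (@continuous_comp S (kprod (Y n) (X n)) (coend Y X)
  (fun s => (y s, x s)) (fun p => coend_class p.1 p.2)); first exact: cyx.
exact: cc.
Qed.

Section coend_lift.
Variables (Y : GammaOpSpace) (X : GammaSpace) (Z : basedSpaceType).
Variable g : forall n, Y n -> X n -> Z.
Hypothesis g_continuous :
  forall n, continuous (fun p : kprod (Y n) (X n) => g p.1 p.2).
Hypothesis g_dinatural : forall m n (a : gamma_hom m n) (y : Y n) (x : X m),
  g (gos_map Y a y) x = g y (gs_map X a x).
Hypothesis g_point : g (point : Y 0) (point : X 0) = point.

Definition gamma_zero m n : gamma_hom m n := @GammaHom m n (fun=> None) erefl.

(** The base point of [Y n] comes from [Y 0] along the zero map; dinaturality moves that map onto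
    [x], which lands in the one-point space [X 0], where [g_point] applies. *)
Let g_pointl n (x : X n) : g (point : Y n) x = point.
Proof.
rewrite -(bm_point (gos_map Y (gamma_zero n 0))) g_dinatural.
by rewrite [gs_map _ _ _]gs_zero.
Qed.

Let g_pointr n (y : Y n) : g y (point : X n) = point.
Proof.
rewrite -(bm_point (gs_map X (gamma_zero 0 n))) -g_dinatural.
by rewrite [gos_map _ _ _]gos_zero.
Qed.

Let g_based n : based_map (kprod (Y n) (X n)) Z :=
  BasedMap (@g_continuous n) (g_pointl point).

Let g_smash_rel n (p q : kprod (Y n) (X n)) :
  on_axes p /\ on_axes q -> g_based n p = g_based n q.
Proof.
have axesE (r : kprod (Y n) (X n)) : on_axes r -> g r.1 r.2 = point.
  by move=> [] ->; [exact: g_pointl|exact: g_pointr].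
by move=> [/axesE hp /axesE hq]; rewrite /= hp hq.
Qed.

Let g_wedge : based_map (coend_sum Y X) Z :=
  bwedge_lift (fun n => bquot_lift (@g_smash_rel n)).

Let g_wedgeE n (y : Y n) (x : X n) : g_wedge (coend_gen y x) = g y x.
Proof.
rewrite /g_wedge /= bwedge_lift_funE /=.
exact: (bquot_lift_funE (@g_smash_rel n)).
Qed.

Let g_coend_rel u v : coend_rel u v -> g_wedge u = g_wedge v.
Proof.
by move=> [m [n [a [y [x [-> ->]]]]]]; rewrite !g_wedgeE g_dinatural.
Qed.

Definition coend_lift : based_map (coend Y X) Z := bquot_lift g_coend_rel.

Lemma coend_liftE n (y : Y n) (x : X n) : coend_lift (coend_class y x) = g y x.
Proof. by rewrite -g_wedgeE; exact: (bquot_lift_funE g_coend_rel). Qed.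

End coend_lift.

(** * Quotient maps onto smash products and finite powers *)

Lemma smash_pair_quotient (A B : basedSpaceType) :
  jointly_quotient (fun (_ : unit) (p : kprod A B) => smash_pair p.1 p.2).
Proof.
split.
- by move=> z; have [a [b ->]] := smash_surj z; exists tt, (a, b).
- move=> _ p.
  have -> : (fun p : kprod A B => smash_pair p.1 p.2) =
      bquot_pi (fun p q : kprod A B => on_axes p /\ on_axes q).
    by apply: funext => -[].
  exact: bquot_pi_continuous.
- move=> U /(_ tt); rewrite bquot_openE; congr open.
  by apply/seteqP; split=> -[].
Qed.

Section kpow_cons.
Variables (K : basedSpaceType) (n : nat).

Definition kpow_cons (p : kprod K (kpow K n)) : kpow K n.+1 :=
  fun i => if unlift ord0 i is Some j then p.2 j else p.1.

Definition kpow_uncons (y : kpow K n.+1) : kprod K (kpow K n) :=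
  (y ord0, fun j => y (lift ord0 j)).

Lemma kpow_cons_continuous : continuous kpow_cons.
Proof.
apply: into_kpow => i; rewrite /kpow_cons; case: (unlift _ _) => [j|] p.
  apply: (@continuous_comp (kprod K (kpow K n)) (kpow K n) K
      (fun p => p.2) (fun y => y j)).
    exact: kprod_snd_continuous.
  exact: kpow_proj_continuous.
exact: kprod_fst_continuous.
Qed.

Lemma kpow_uncons_continuous : continuous kpow_uncons.
Proof.
apply: into_kprod; first exact: kpow_proj_continuous.
by apply: into_kpow => j; exact: kpow_proj_continuous.
Qed.

Lemma kpow_unconsK : cancel kpow_uncons kpow_cons.
Proof.
move=> y; apply: funext => i; rewrite /kpow_cons /=.
by case: unliftP => [j|] ->.
Qed.
End kpow_cons.

(** Induction on [n]: under the splitting of a power as first entry times the rest, the map is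
    [id x q^n] followed by [q x id], both quotient maps by the product lemmas. *)
Lemma kpow_quotient (A B : basedSpaceType) (q : A -> B) n :
  jointly_quotient (fun _ : unit => q) ->
  jointly_quotient (A := fun=> kpow A n) (B := kpow B n)
    (fun (_ : unit) y i => q (y i)).
Proof.
move=> qq; have [qs qc _] := qq.
have cpow m : continuous (fun (y : kpow A m) => (fun i => q (y i)) : kpow B m).
  apply: into_kpow => i y.
  apply: (@continuous_comp (kpow A m) A B (fun y => y i) q).
    exact: kpow_proj_continuous.
  exact: (qc tt).
have spow m (y : kpow B m) : exists (_ : unit) (x : kpow A m),
    (fun i => q (x i)) = y.
  have /choice[x xE] : forall i, exists a, q a = y i.
    by move=> i; have [_ [a]] := qs (y i); exists a.
  by exists tt, x; exact: funext.
elim: n => [|n IHn]; split=> [||U /(_ tt) oU];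
  [exact: spow|move=> _; exact: cpow| |exact: spow|move=> _; exact: cpow|].
  (* For [n = 0] the powers are single points, and the constant map back is a continuous section. *)
  have cs : continuous (fun y : kpow B 0 => point : kpow A 0).
    exact: cst_continuous.
  move/continuousP: cs => /(_ _ oU); congr open.
  by apply/seteqP; split=> y /=; have -> : y = (fun=> q point)
    by apply: funext => -[].
have -> : U = @kpow_uncons B n @^-1` (@kpow_cons B n @^-1` U).
  by apply/seteqP; split=> y /=; rewrite kpow_unconsK.
move/continuousP: (@kpow_uncons_continuous B n); apply.
have [_ _ ql] := jointly_quotient_prodl (kpow B n) qq; apply: ql => _.
have [_ _ qr] := jointly_quotient_prodr A IHn; apply: qr => _.
have consE (p : kprod A (kpow A n)) :
    (fun i => q (kpow_cons p i)) =
    kpow_cons ((q p.1, fun i => q (p.2 i)) : kprod B (kpow B n)).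
  by apply: funext => i; rewrite /kpow_cons /=; case: (unlift _ _).
have /continuousP /(_ _ oU) := @kpow_cons_continuous A n.
by congr open; apply/seteqP; split=> p /=; rewrite consE.
Qed.

(** * Morphisms of the category Gamma: diagonals, projections, restrictions *)

(* The smash product of the identity of {1, ..., q}_+ with the diagonal of
   {1, ..., p}_+, the target being bracketed as (q * p) * p. *)
Definition gamma_diag q p : gamma_hom (q * p) (q * p * p) :=
  @GammaHom _ _ (omap (fun k => lex k (unlex k).2)) erefl.

(** The lexicographic numbers of ((a, b), c) and (a, (b, c)) are equal, so only the type of the
    index changes. *)
Definition lex_assoc q n m (k : 'I_(q * n * m)) : 'I_(q * (n * m)) :=
  lex (unlex (unlex k).1).1 (lex (unlex (unlex k).1).2 (unlex k).2).

Definition gamma_assoc q n m : gamma_hom (q * n * m) (q * (n * m)) :=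
  @GammaHom _ _ (omap (@lex_assoc q n m)) erefl.

(** Smash product of an identity with a fold map to {1}_+ . Pullback along it repeats each entry of
    a family [m] times. *)
Definition gamma_fst n m : gamma_hom (n * m) n :=
  @GammaHom _ _ (omap (fun k : 'I_(n * m) => (unlex k).1)) erefl.

Definition gamma_snd n m : gamma_hom (n * m) m :=
  @GammaHom _ _ (omap (fun k : 'I_(n * m) => (unlex k).2)) erefl.

(** The maps e of the overview: pullback replaces the entries outside [P] by the base point. *)
Definition gamma_restrict n (P : pred 'I_n) : gamma_hom n n :=
  @GammaHom _ _ (obind (fun i => if P i then Some i else None)) erefl.

Lemma unlex1K n m (i : 'I_n) (j : 'I_m) : (unlex (lex i j)).1 = i.
Proof. by rewrite lexK. Qed.

Lemma unlex2K n m (i : 'I_n) (j : 'I_m) : (unlex (lex i j)).2 = j.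
Proof. by rewrite lexK. Qed.

Lemma lex_ind n m (P : 'I_(n * m) -> Prop) :
  (forall i j, P (lex i j)) -> forall k, P k.
Proof. by move=> h k; rewrite -(unlexK k). Qed.

Lemma gamma_smash_lexE n n' m m' (a : gamma_hom n n') (b : gamma_hom m m')
    (i : 'I_n) (j : 'I_m) :
  gamma_smash a b (Some (lex i j)) =
  if a (Some i) is Some i' then
    if b (Some j) is Some j' then Some (lex i' j') else None
  else None.
Proof.
by rewrite -[LHS]/(match a (Some (unlex (lex i j)).1),
  b (Some (unlex (lex i j)).2) with
  | Some i, Some j => Some (lex i j) | _, _ => None end) lexK.
Qed.

Lemma gamma_diag_lexE q p (i : 'I_q) (j : 'I_p) :
  gamma_diag q p (Some (lex i j)) = Some (lex (lex i j) j).
Proof. by congr (Some (lex _ _)); exact: unlex2K. Qed.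

Lemma gamma_assoc_lexE q n m (a : 'I_q) (b : 'I_n) (c : 'I_m) :
  gamma_assoc q n m (Some (lex (lex a b) c)) = Some (lex a (lex b c)).
Proof. by congr Some; rewrite /lex_assoc !(unlex1K, unlex2K). Qed.

Lemma gamma_fst_lexE n m (i : 'I_n) (j : 'I_m) :
  gamma_fst n m (Some (lex i j)) = Some i.
Proof. by congr Some; exact: unlex1K. Qed.

Lemma gamma_snd_lexE n m (i : 'I_n) (j : 'I_m) :
  gamma_snd n m (Some (lex i j)) = Some j.
Proof. by congr Some; exact: unlex2K. Qed.

Definition lexE := (gamma_smash_lexE, gamma_diag_lexE, gamma_assoc_lexE,
  gamma_fst_lexE, gamma_snd_lexE).

Lemma gamma_compE m n p (g : gamma_hom n p) (f : gamma_hom m n) i :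
  gamma_comp g f i = g (f i).
Proof. by []. Qed.

Lemma gamma_idE n i : gamma_id n i = i. Proof. by []. Qed.

Lemma gamma_diag_natural q q' n n' (a : gamma_hom q q') (b : gamma_hom n n') :
  gamma_comp (gamma_diag q' n') (gamma_smash a b) =
  gamma_comp (gamma_smash (gamma_smash a b) b) (gamma_diag q n).
Proof.
apply: gamma_hom_eq => -[k|//]; elim/lex_ind: k => i j.
rewrite !gamma_compE !lexE; case: (a _) => [i'|]; last by rewrite gh_point.
by case E: (b _) => [j'|]; rewrite ?gh_point ?lexE ?E.
Qed.

(** After the diagonal both copies of an index agree, so restricting either copy to [P] kills the
    same elements. This lets a restriction pass between [k] and [l]. *)
Lemma gamma_diag_restrict q n (P : pred 'I_n) :
  gamma_comp (gamma_smash (gamma_smash (gamma_id q) (gamma_restrict P))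
    (gamma_id n)) (gamma_diag q n) =
  gamma_comp (gamma_smash (gamma_id (q * n)) (gamma_restrict P))
    (gamma_diag q n).
Proof.
apply: gamma_hom_eq => -[k|//]; elim/lex_ind: k => i j.
by rewrite !gamma_compE !lexE /=; case: (P j).
Qed.

Lemma gamma_assoc_natural q q' n n' m m' (a : gamma_hom q q')
    (b : gamma_hom n n') (c : gamma_hom m m') :
  gamma_comp (gamma_assoc q' n' m') (gamma_smash (gamma_smash a b) c) =
  gamma_comp (gamma_smash a (gamma_smash b c)) (gamma_assoc q n m).
Proof.
apply: gamma_hom_eq => -[k|//]; elim/lex_ind: k => k l.
elim/lex_ind: k => i j.
rewrite !gamma_compE !lexE.
case: (a _) => [i'|]; last by rewrite gh_point.
case: (b _) => [j'|]; last by rewrite gh_point.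
case: (c _) => [l'|]; last by rewrite gh_point.
by rewrite lexE.
Qed.

(** The diagonal doubles the pair (a, b), and the two projections keep a from one copy and b from
    the other. This gives one of the two inverse laws. *)
Lemma gamma_diag_proj q n m :
  gamma_comp
    (gamma_comp
      (gamma_smash (gamma_smash (gamma_id q) (gamma_fst n m)) (gamma_snd n m))
      (gamma_diag q (n * m)))
    (gamma_assoc q n m) =
  gamma_id (q * n * m).
Proof.
apply: gamma_hom_eq => -[k|//]; elim/lex_ind: k => k l.
elim/lex_ind: k => i j.
by rewrite !gamma_compE !(lexE, gamma_idE).
Qed.

Definition gamma_dup n : gamma_hom n (n * n) :=
  @GammaHom _ _ (omap (fun i => lex i i)) erefl.

Lemma gamma_assoc_diag q n :
  gamma_comp (gamma_assoc q n n) (gamma_diag q n) =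
  gamma_smash (gamma_id q) (gamma_dup n).
Proof.
apply: gamma_hom_eq => -[k|//]; elim/lex_ind: k => i j.
by rewrite !gamma_compE !(lexE, gamma_idE).
Qed.

(** * Classes in the iterated construction and their relations *)

Lemma SPinf_gs_mapE (K : basedSpaceType) (X : GammaSpace) m n
    (a : gamma_hom m n) p (k : kpow K p) (x : X (m * p)) :
  gs_map (SPinf K X) a (@coend_class (power K) (shift X m) p k x) =
  @coend_class (power K) (shift X n) p k
    (gs_map X (gamma_smash a (gamma_id p)) x).
Proof.
exact: (@coend_mapE (power K) (power K) (shift X m) (shift X n)
  (power_nat (based_id K)) (shift_hom X a) p k x).
Qed.

Lemma SPinf_mapE (K K' : basedSpaceType) (X X' : GammaSpace)
    (f : based_map K K') (g : gamma_nat X X') n p (k : kpow K p)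
    (x : X (n * p)) :
  SPinf_map f g n (@coend_class (power K) (shift X n) p k x) =
  @coend_class (power K') (shift X' n) p (power_nat f p k) (g (n * p) x).
Proof.
exact: (@coend_mapE (power K) (power K') (shift X n) (shift X' n)
  (power_nat f) (shift_fun g n) p k x).
Qed.

Lemma kpow_restrict_id (M : basedSpaceType) n (P : pred 'I_n) (y : kpow M n) :
  (forall i, ~~ P i -> y i = point) -> kpow_map M (gamma_restrict P) y = y.
Proof.
move=> yP; apply: funext => i; rewrite /= /kpow_map_fun /=.
by case: ifPn => // /yP ->.
Qed.

Lemma kpow_restrict_idem (M : basedSpaceType) n (P : pred 'I_n) (y : kpow M n) :
  kpow_map M (gamma_restrict P) (kpow_map M (gamma_restrict P) y) =
  kpow_map M (gamma_restrict P) y.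
Proof.
apply: kpow_restrict_id => i /negbTE nP.
by rewrite /= /kpow_map_fun /= nP.
Qed.

(** The relation that collapses the axes is already symmetric and transitive, so generating an
    equivalence only adds reflexivity. *)
Lemma smash_pair_eq (A B : basedSpaceType) (p p' : kprod A B) :
  smash_pair p.1 p.2 = smash_pair p'.1 p'.2 ->
  p = p' \/ on_axes p /\ on_axes p'.
Proof.
case: p p' => [a b] [a' b'] /= /bquot_piP.
elim=> [u v|u|u v _|u v w _ h1 _ h2]; first by right.
- by left.
- by move=> [->|[]]; [left|right].
- by case: h1 h2 => [->//|[hu hv]] [<-|[_ hw]]; right.
Qed.

Section double_class.
Variables (K L : basedSpaceType) (X : GammaSpace) (q : nat).

(** The class [k; [l; x]] of the overview. *)
Definition double_class n m (k : kpow K n) (l : kpow L m) (x : X (q * n * m)) :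
    SPinf K (SPinf L X) q :=
  @coend_class (power K) (shift (SPinf L X) q) n k
    (@coend_class (power L) (shift X (q * n)) m l x).

Lemma double_class_movel n n' m (a : gamma_hom n' n) (k : kpow K n)
    (l : kpow L m) (x : X (q * n' * m)) :
  double_class (kpow_map K a k) l x =
  double_class k l
    (gs_map X (gamma_smash (gamma_smash (gamma_id q) a) (gamma_id m)) x).
Proof.
rewrite /double_class.
rewrite (@coend_classE (power K) (shift (SPinf L X) q) n' n a k).
by congr coend_class; exact: SPinf_gs_mapE.
Qed.

Lemma double_class_mover n m m' (b : gamma_hom m' m) (k : kpow K n)
    (l : kpow L m) (x : X (q * n * m')) :
  double_class k (kpow_map L b l) x =
  double_class k l (gs_map X (gamma_smash (gamma_id (q * n)) b) x).
Proof.
rewrite /double_class; congr coend_class.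
exact: (@coend_classE (power L) (shift X (q * n)) m' m b l).
Qed.

Lemma double_class_move n n' m m' (a : gamma_hom n' n) (b : gamma_hom m' m)
    (k : kpow K n) (l : kpow L m) (x : X (q * n' * m')) :
  double_class (kpow_map K a k) (kpow_map L b l) x =
  double_class k l
    (gs_map X (gamma_smash (gamma_smash (gamma_id q) a) b) x).
Proof.
rewrite double_class_movel double_class_mover -gs_map_comp -gamma_smash_comp.
by congr (double_class _ _ (gs_map X (gamma_smash _ _) _)); exact: gamma_hom_eq.
Qed.

Lemma double_class_point n m (k : kpow K n) (l : kpow L m) :
  double_class k l point = point.
Proof.
by rewrite /double_class (@coend_class_point (power L) (shift X (q * n)))
  (@coend_class_point (power K) (shift (SPinf L X) q)).
Qed.

Lemma double_class_continuous (S : basedSpaceType) n m (k : S -> kpow K n)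
    (l : S -> kpow L m) (x : S -> X (q * n * m)) :
  continuous k -> continuous l -> continuous x ->
  continuous (fun s => double_class (k s) (l s) (x s)).
Proof.
move=> ck cl cx.
apply: (@coend_class_continuous (power K) (shift (SPinf L X) q)) => //.
exact: (@coend_class_continuous (power L) (shift X (q * n))).
Qed.

Definition diag_class n (k : kpow K n) (l : kpow L n) (x : X (q * n)) :=
  double_class k l (gs_map X (gamma_diag q n) x).

Lemma diag_class_move n n' (a : gamma_hom n' n) (k : kpow K n) (l : kpow L n)
    (x : X (q * n')) :
  diag_class (kpow_map K a k) (kpow_map L a l) x =
  diag_class k l (gs_map X (gamma_smash (gamma_id q) a) x).
Proof.
by rewrite /diag_class double_class_move -!gs_map_comp gamma_diag_natural.
Qed.

Lemma diag_class_swap n (P : pred 'I_n) (k : kpow K n) (l : kpow L n)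
    (x : X (q * n)) :
  diag_class (kpow_map K (gamma_restrict P) k) l x =
  diag_class k (kpow_map L (gamma_restrict P) l) x.
Proof.
rewrite /diag_class double_class_movel double_class_mover -!gs_map_comp.
by rewrite gamma_diag_restrict.
Qed.

(** Both restrictions are gathered on the family that vanishes outside [P], where they are
    idempotent and act trivially. *)
Lemma diag_class_restrict n (P : pred 'I_n) (k : kpow K n) (l : kpow L n)
    (x : X (q * n)) :
  (forall i, ~~ P i -> k i = point) \/ (forall i, ~~ P i -> l i = point) ->
  diag_class (kpow_map K (gamma_restrict P) k)
    (kpow_map L (gamma_restrict P) l) x = diag_class k l x.
Proof.
move=> [kP|lP].
- by rewrite -diag_class_swap kpow_restrict_idem kpow_restrict_id.
- by rewrite diag_class_swap kpow_restrict_idem kpow_restrict_id.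
Qed.

(* Both sides are unchanged when [k] and [l] are replaced by the base point at
   all the indices where one of them is the base point. *)
Lemma diag_class_smash n (k k' : kpow K n) (l l' : kpow L n) (x : X (q * n)) :
  (forall i, smash_pair (k i) (l i) = smash_pair (k' i) (l' i)) ->
  diag_class k l x = diag_class k' l' x.
Proof.
move=> kl.
pose nz (M : basedSpaceType) (y : kpow M n) : pred 'I_n :=
  fun i => y i != point.
pose R (M : basedSpaceType) k l (y : kpow M n) :=
  kpow_map M (gamma_restrict (nz L l)) (kpow_map M (gamma_restrict (nz K k)) y).
(* The outer restriction is removed because the second family vanishes where [v] does, the inner one
   because [u] vanishes outside [nz K u]. *)
have RE u v : diag_class (R K u v u) (R L u v v) x = diag_class u v x.
  rewrite /R diag_class_restrict; last first.
    right=> i /negbTE nli; rewrite /= /kpow_map_fun /=.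
    by case: ifP => // _ /=; move: nli => /negbFE/eqP.
  by rewrite diag_class_restrict //; left => i /negPn/eqP.
have RiE (M : basedSpaceType) u v (y : kpow M n) i :
    R M u v y i = if (v i != point) && (u i != point) then y i else point.
  rewrite /R /= /kpow_map_fun /= /nz; case: ifP => //= _.
  by rewrite /kpow_map_fun /=; case: ifP.
have axesP (p : kprod K L) :
    on_axes p -> (p.2 != point) && (p.1 != point) = false.
  by move=> [] ->; rewrite eqxx ?andbF.
(* At each index the two pairs are equal, or both lie on the axes and all masked entries are base
   points. *)
rewrite -RE -[RHS]RE; congr (diag_class _ _ x); apply: funext => i;
  rewrite !RiE; have [[-> ->//]|[/axesP/= -> /axesP/= ->//]] :=
    @smash_pair_eq _ _ (k i, l i) (k' i, l' i) (kl i).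
Qed.
End double_class.

Lemma double_class_gs_map (K L : basedSpaceType) (X : GammaSpace) q q'
    (a : gamma_hom q q') n m (k : kpow K n) (l : kpow L m) (x : X (q * n * m)) :
  gs_map (SPinf K (SPinf L X)) a (double_class k l x) =
  double_class k l
    (gs_map X (gamma_smash (gamma_smash a (gamma_id n)) (gamma_id m)) x).
Proof.
rewrite /double_class [LHS](@SPinf_gs_mapE K (SPinf L X)).
by congr coend_class; exact: SPinf_gs_mapE.
Qed.

Lemma double_class_SPinf_map (K K' L L' : basedSpaceType) (X X' : GammaSpace)
    (f : based_map K K') (g : based_map L L') (h : gamma_nat X X') q n m
    (k : kpow K n) (l : kpow L m) (x : X (q * n * m)) :
  SPinf_map f (SPinf_map g h) q (double_class k l x) =
  double_class (power_nat f n k) (power_nat g m l) (h (q * n * m) x).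
Proof.
rewrite /double_class [LHS]SPinf_mapE.
by congr coend_class; exact: SPinf_mapE.
Qed.

(** * The natural map to the iterated construction *)

Section iso.
Variables (K L : basedSpaceType) (X : GammaSpace).

Definition kpow_smash n (k : kpow K n) (l : kpow L n) : kpow (smash K L) n :=
  fun i => smash_pair (k i) (l i).

Lemma kpow_smash_surj n (s : kpow (smash K L) n) :
  exists k l, s = kpow_smash k l.
Proof.
have /choice[p pE] : forall i, exists p : K * L, s i = smash_pair p.1 p.2.
  by move=> i; have [a [b sE]] := smash_surj (s i); exists (a, b).
exists (fun i => (p i).1), (fun i => (p i).2).
by apply: funext => i; rewrite pE.
Qed.

Lemma kpow_smash_map m n (a : gamma_hom m n) (k : kpow K n) (l : kpow L n) :
  kpow_map (smash K L) a (kpow_smash k l) =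
  kpow_smash (kpow_map K a k) (kpow_map L a l).
Proof.
apply: funext => i; rewrite /kpow_smash /= /kpow_map_fun.
by case: (a _).
Qed.

Lemma kpow_smash_continuous (S : basedSpaceType) n (k : S -> kpow K n)
    (l : S -> kpow L n) :
  continuous k -> continuous l -> continuous (fun s => kpow_smash (k s) (l s)).
Proof.
move=> ck cl; apply: into_kpow => i.
have cp (M : basedSpaceType) (y : S -> kpow M n) :
    continuous y -> continuous (fun s => y s i).
  move=> cy s; apply: (@continuous_comp S (kpow M n) M y (fun z => z i)).
    exact: cy.
  exact: kpow_proj_continuous.
have ckl : continuous (fun s => (k s i, l s i) : kprod K L).
  by apply: into_kprod; exact: cp.
have [_ cs _] := smash_pair_quotient K L.
move=> s; apply: (@continuous_comp S (kprod K L) (smash K L)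
  (fun s => (k s i, l s i)) (fun p => smash_pair p.1 p.2)); first exact: ckl.
exact: (cs tt).
Qed.

(** Representatives are chosen arbitrarily; by [diag_class_smash] the resulting class does not
    depend on the choice. *)
Definition kpow_pick n (s : kpow (smash K L) n) : kpow (kprod K L) n :=
  fun i => repr (s i).

Definition split_gen q n (s : kpow (smash K L) n) (x : X (q * n)) :
    SPinf K (SPinf L X) q :=
  diag_class (fun i => (kpow_pick s i).1) (fun i => (kpow_pick s i).2) x.

Lemma split_genE q n (k : kpow K n) (l : kpow L n) (x : X (q * n)) :
  split_gen (kpow_smash k l) x = diag_class k l x.
Proof.
apply: diag_class_smash => i; rewrite /kpow_pick.
rewrite -[RHS](reprK (kpow_smash k l i)) /smash_pair.
by rewrite -surjective_pairing.
Qed.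

(** Continuity is tested after pulling back along the quotient map from (K x L)^n x X(qn), where the
    choice of representatives gives way to an explicit formula. *)
Lemma split_gen_continuous q n :
  continuous (fun p : kprod (kpow (smash K L) n) (X (q * n)) =>
    split_gen p.1 p.2).
Proof.
have qq := jointly_quotient_prodl (X (q * n))
  (kpow_quotient n (smash_pair_quotient K L)).
apply: (jointly_quotient_continuous qq) => _.
rewrite (_ : _ \o _ = fun p : kprod (kpow (kprod K L) n) (X (q * n)) =>
  diag_class (fun i => (p.1 i).1) (fun i => (p.1 i).2) p.2); last first.
  by apply: funext => p; exact: split_genE.
have cfst (S : basedSpaceType) (f : S -> kprod K L) :
    continuous f -> continuous (fun s => (f s).1).
  move=> cf s; apply: (@continuous_comp S (kprod K L) K f (fun p => p.1)).
    exact: cf.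
  exact: kprod_fst_continuous.
have csnd (S : basedSpaceType) (f : S -> kprod K L) :
    continuous f -> continuous (fun s => (f s).2).
  move=> cf s; apply: (@continuous_comp S (kprod K L) L f (fun p => p.2)).
    exact: cf.
  exact: kprod_snd_continuous.
have cproj i : continuous
    (fun p : kprod (kpow (kprod K L) n) (X (q * n)) => p.1 i).
  move=> p; apply: (@continuous_comp (kprod (kpow (kprod K L) n) (X (q * n)))
    (kpow (kprod K L) n) (kprod K L) (fun p => p.1) (fun y => y i)).
    exact: kprod_fst_continuous.
  exact: kpow_proj_continuous.
apply: double_class_continuous.
- by apply: into_kpow => i; exact: (cfst _ _ (cproj i)).
- by apply: into_kpow => i; exact: (csnd _ _ (cproj i)).
- move=> p; apply: (@continuous_comp (kprod (kpow (kprod K L) n) (X (q * n)))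
    (X (q * n)) (X (q * n * n)) (fun p => p.2) (gs_map X (gamma_diag q n))).
    exact: kprod_snd_continuous.
  exact: bm_continuous.
Qed.

Lemma split_gen_dinatural q m n (a : gamma_hom m n) (s : kpow (smash K L) n)
    (x : X (q * m)) :
  split_gen (kpow_map (smash K L) a s) x =
  split_gen s (gs_map X (gamma_smash (gamma_id q) a) x).
Proof.
have [k [l ->]] := kpow_smash_surj s.
by rewrite kpow_smash_map !split_genE diag_class_move.
Qed.

Lemma split_gen_point q :
  split_gen (point : kpow (smash K L) 0) (point : X (q * 0)) = point.
Proof. by rewrite /split_gen /diag_class bm_point double_class_point. Qed.

Definition SPinf_split q :
    based_map (SPinf (smash K L) X q) (SPinf K (SPinf L X) q) :=
  @coend_lift (power (smash K L)) (shift X q) _ (@split_gen q)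
    (@split_gen_continuous q) (@split_gen_dinatural q) (split_gen_point q).

Lemma SPinf_splitE q n (k : kpow K n) (l : kpow L n) (x : X (q * n)) :
  SPinf_split q
    (@coend_class (power (smash K L)) (shift X q) n (kpow_smash k l) x) =
  diag_class k l x.
Proof. by rewrite /SPinf_split coend_liftE split_genE. Qed.

Lemma SPinf_smash_ind q (P : SPinf (smash K L) X q -> Prop) :
  (forall n (k : kpow K n) (l : kpow L n) (x : X (q * n)),
    P (@coend_class (power (smash K L)) (shift X q) n (kpow_smash k l) x)) ->
  forall z, P z.
Proof.
move=> h z; have [n [s [x ->]]] := coend_surj z.
by have [k [l ->]] := kpow_smash_surj s; exact: h.
Qed.

Lemma SPinf_split_natural m n (a : gamma_hom m n) (z : SPinf (smash K L) X m) :
  SPinf_split n (gs_map (SPinf (smash K L) X) a z) =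
  gs_map (SPinf K (SPinf L X)) a (SPinf_split m z).
Proof.
elim/SPinf_smash_ind: z => p k l x.
rewrite SPinf_gs_mapE 2!SPinf_splitE /diag_class double_class_gs_map.
by rewrite -!gs_map_comp gamma_diag_natural.
Qed.

Definition SPinf_split_nat :
    gamma_nat (SPinf (smash K L) X) (SPinf K (SPinf L X)) :=
  GammaNat SPinf_split_natural.
End iso.

(** * The inverse map, built by two successive lifts from coends *)

Section inverse.
Variables (K L : basedSpaceType) (X : GammaSpace) (q : nat).

(** The family (k_a ^ l_b) in lexicographic order, written with pullbacks along projections so that
    the coend relations apply to it. *)
Definition kpow_exterior n m (k : kpow K n) (l : kpow L m) :
    kpow (smash K L) (n * m) :=
  kpow_smash (kpow_map K (gamma_fst n m) k) (kpow_map L (gamma_snd n m) l).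

Lemma kpow_exterior_lexE n m (k : kpow K n) (l : kpow L m) i j :
  kpow_exterior k l (lex i j) = smash_pair (k i) (l j).
Proof.
by congr (smash_pair (k _) (l _)); [exact: unlex1K|exact: unlex2K].
Qed.

Lemma kpow_exterior_map n n' m m' (a : gamma_hom n' n) (b : gamma_hom m' m)
    (k : kpow K n) (l : kpow L m) :
  kpow_map (smash K L) (gamma_smash a b) (kpow_exterior k l) =
  kpow_exterior (kpow_map K a k) (kpow_map L b l).
Proof.
(* An index killed by only one of [a], [b] gives the base point on the left and a pair on an axis on
   the right. *)
have pl (y : L) : point = smash_pair (point : K) y.
  by apply: bquot_pi_rel; split; left.
have pr (x : K) : point = smash_pair x (point : L).
  by apply: bquot_pi_rel; split; right.
apply: funext => i; elim/lex_ind: i => i j.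
rewrite kpow_exterior_lexE.
rewrite -[LHS]/(kpow_ext _ (gamma_smash a b (Some (lex i j)))).
rewrite gamma_smash_lexE.
rewrite -[kpow_map K a k i]/(kpow_ext k (a (Some i))).
rewrite -[kpow_map L b l j]/(kpow_ext l (b (Some j))).
case: (a _) => [i'|]; last exact: pl.
case: (b _) => [j'|]; last exact: pr.
exact: kpow_exterior_lexE.
Qed.

Definition merge_gen n (k : kpow K n) m (l : kpow L m) (x : X (q * n * m)) :
    SPinf (smash K L) X q :=
  @coend_class (power (smash K L)) (shift X q) (n * m) (kpow_exterior k l)
    (gs_map X (gamma_assoc q n m) x).

Lemma merge_gen_continuous (S : basedSpaceType) n m (k : S -> kpow K n)
    (l : S -> kpow L m) (x : S -> X (q * n * m)) :
  continuous k -> continuous l -> continuous x ->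
  continuous (fun s => merge_gen (k s) (l s) (x s)).
Proof.
move=> ck cl cx.
have cbm (A B : basedSpaceType) (f : based_map A B) (g : S -> A) :
    continuous g -> continuous (fun s => f (g s)).
  by move=> cg s; apply: (@continuous_comp S A B g f);
    [exact: cg|exact: bm_continuous].
apply: (@coend_class_continuous (power (smash K L)) (shift X q)).
  by apply: kpow_smash_continuous; exact: cbm.
exact: cbm.
Qed.

Lemma merge_gen_move n n' m m' (a : gamma_hom n' n) (b : gamma_hom m' m)
    (k : kpow K n) (l : kpow L m) (x : X (q * n' * m')) :
  merge_gen (kpow_map K a k) (kpow_map L b l) x =
  merge_gen k l (gs_map X (gamma_smash (gamma_smash (gamma_id q) a) b) x).
Proof.
rewrite /merge_gen -kpow_exterior_map.
rewrite (@coend_classE (power (smash K L)) (shift X q)); congr coend_class.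
by rewrite /= /shift_map -!gs_map_comp gamma_assoc_natural.
Qed.

Lemma merge_gen_dinatural n (k : kpow K n) m' m (b : gamma_hom m' m)
    (l : kpow L m) (x : X (q * n * m')) :
  merge_gen k (kpow_map L b l) x =
  merge_gen k l (gs_map X (gamma_smash (gamma_id (q * n)) b) x).
Proof. by rewrite -gamma_smash_id -merge_gen_move kpow_map_id. Qed.

Lemma merge_gen_point n (k : kpow K n) m (l : kpow L m) :
  merge_gen k l point = point.
Proof.
by rewrite /merge_gen bm_point (@coend_class_point (power _) (shift X q)).
Qed.

Lemma merge_gen_pair_continuous n (k : kpow K n) m :
  continuous (fun p : kprod (kpow L m) (X (q * n * m)) => merge_gen k p.1 p.2).
Proof.
apply: merge_gen_continuous; first exact: cst_continuous.
- exact: kprod_fst_continuous.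
- exact: kprod_snd_continuous.
Qed.

Definition merge_inner n (k : kpow K n) :
    based_map (SPinf L X (q * n)) (SPinf (smash K L) X q) :=
  @coend_lift (power L) (shift X (q * n)) _ (merge_gen k)
    (@merge_gen_pair_continuous n k)
    (@merge_gen_dinatural n k) (@merge_gen_point n k 0 point).

Lemma merge_innerE n (k : kpow K n) m (l : kpow L m) (x : X (q * n * m)) :
  merge_inner k (@coend_class (power L) (shift X (q * n)) m l x) =
  merge_gen k l x.
Proof. exact: coend_liftE. Qed.

(** The outer lift requires continuity jointly in [k] and the inner class; the product with
    [kpow K n] preserves the joint quotient onto the inner coend. *)
Lemma merge_inner_continuous n : continuous
  (fun p : kprod (kpow K n) (SPinf L X (q * n)) => merge_inner p.1 p.2).
Proof.
have qq := jointly_quotient_prodr (kpow K n)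
  (coend_class_jointly_quotient (power L) (shift X (q * n))).
apply: (jointly_quotient_continuous qq) => m.
rewrite (_ : _ \o _ =
  fun p : kprod (kpow K n) (kprod (kpow L m) (X (q * n * m))) =>
  merge_gen p.1 p.2.1 p.2.2); last by apply: funext => p; exact: merge_innerE.
apply: merge_gen_continuous; first exact: kprod_fst_continuous.
- move=> p; apply: (@continuous_comp
    (kprod (kpow K n) (kprod (kpow L m) (X (q * n * m))))
    (kprod (kpow L m) (X (q * n * m))) (kpow L m)
    (fun p => p.2) (fun p => p.1)); first exact: kprod_snd_continuous.
  exact: kprod_fst_continuous.
- move=> p; apply: (@continuous_comp
    (kprod (kpow K n) (kprod (kpow L m) (X (q * n * m))))
    (kprod (kpow L m) (X (q * n * m))) (X (q * n * m))
    (fun p => p.2) (fun p => p.2)); first exact: kprod_snd_continuous.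
  exact: kprod_snd_continuous.
Qed.

Lemma merge_inner_dinatural n' n (a : gamma_hom n' n) (k : kpow K n)
    (z : SPinf L X (q * n')) :
  merge_inner (kpow_map K a k) z =
  merge_inner k (gs_map (SPinf L X) (gamma_smash (gamma_id q) a) z).
Proof.
have [m [l [x ->]]] := coend_surj z.
rewrite merge_innerE SPinf_gs_mapE merge_innerE.
by rewrite -[in LHS](kpow_map_id l) merge_gen_move.
Qed.

Definition SPinf_merge :
    based_map (SPinf K (SPinf L X) q) (SPinf (smash K L) X q) :=
  @coend_lift (power K) (shift (SPinf L X) q) _ (fun n k => merge_inner k)
    merge_inner_continuous merge_inner_dinatural (bm_point _).

Lemma SPinf_mergeE n (k : kpow K n) m (l : kpow L m) (x : X (q * n * m)) :
  SPinf_merge (double_class k l x) = merge_gen k l x.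
Proof. by rewrite /SPinf_merge /double_class coend_liftE merge_innerE. Qed.

Lemma SPinf_splitK : cancel (SPinf_split K L X q) SPinf_merge.
Proof.
elim/SPinf_smash_ind => n k l x; rewrite SPinf_splitE SPinf_mergeE /merge_gen.
rewrite -gs_map_comp gamma_assoc_diag.
(* The coend relation moves [gamma_dup] onto the exterior family, whose diagonal entries are the k_i
   ^ l_i. *)
rewrite -[gs_map X _ x]/(gs_map (shift X q) (gamma_dup n) x).
rewrite -(@coend_classE (power (smash K L)) (shift X q)).
congr coend_class.
by apply: funext => i; exact: kpow_exterior_lexE.
Qed.

Lemma SPinf_mergeK : cancel SPinf_merge (SPinf_split K L X q).
Proof.
move=> z; have [n [k [w ->]]] := coend_surj z.
have [m [l [x ->]]] := coend_surj w.
rewrite -/(double_class k l x) SPinf_mergeE /merge_gen SPinf_splitE /diag_class.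
(* The projections defining the exterior family move onto [x] and cancel the diagonal and the
   reassociation. *)
by rewrite double_class_move -2!gs_map_comp gamma_diag_proj gs_map_id.
Qed.

End inverse.

(** * Naturality in all three variables and the isomorphism *)

Lemma SPinf_split_map (K K' L L' : basedSpaceType) (X X' : GammaSpace)
    (k : based_map K K') (l : based_map L L') (f : gamma_nat X X')
    (n : nat) (z : SPinf (smash K L) X n) :
  SPinf_split K' L' X' n (SPinf_map (smash_map k l) f n z) =
  SPinf_map k (SPinf_map l f) n (SPinf_split K L X n z).
Proof.
elim/SPinf_smash_ind: z => p y w x.
rewrite SPinf_splitE SPinf_mapE.
have -> : power_nat (smash_map k l) p (kpow_smash y w) =
    kpow_smash (power_nat k p y) (power_nat l p w).
  by apply: funext => i; exact: smash_mapE.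
by rewrite SPinf_splitE /diag_class double_class_SPinf_map gn_natural.
Qed.

Theorem proposition3p6 :
  exists phi : forall (K L : basedSpaceType) (X : GammaSpace),
      gamma_nat (SPinf (smash K L) X) (SPinf K (SPinf L X)),
    (forall (K L : basedSpaceType) (X : GammaSpace), gamma_is_iso (phi K L X)) /\
    (forall (K K' L L' : basedSpaceType) (X X' : GammaSpace)
        (k : based_map K K') (l : based_map L L') (f : gamma_nat X X')
        (n : nat) (z : SPinf (smash K L) X n),
      phi K' L' X' n (SPinf_map (smash_map k l) f n z) =
      SPinf_map k (SPinf_map l f) n (phi K L X n z)).
Proof.
exists SPinf_split_nat.
split=> [K L X|K K' L L' X X' k l f n z]; last exact: SPinf_split_map.
(* A levelwise inverse of a natural map is natural: write [z] as the image of its merge, then apply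
   the inverse to the naturality square. *)
have merge_natural m n (a : gamma_hom m n) (z : SPinf K (SPinf L X) m) :
    SPinf_merge K L X n (gs_map (SPinf K (SPinf L X)) a z) =
    gs_map (SPinf (smash K L) X) a (SPinf_merge K L X m z).
  have E := congr1 (SPinf_merge K L X n)
    (SPinf_split_natural a (SPinf_merge K L X m z)).
  exact: etrans (congr1 (fun w => SPinf_merge K L X n (gs_map _ a w))
    (esym (SPinf_mergeK z))) (etrans (esym E) (SPinf_splitK _)).
exists (GammaNat merge_natural) => n.
by split; [exact: SPinf_splitK|exact: SPinf_mergeK].
Qed.
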